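(* The logic $\mathsf{M^{+}IPC}$ has the finite model property: if $\mathsf{M^{+}IPC}\not\vdash\varphi$, then there is a finite $\mathsf{M^{+}IPC}$-frame $\mathfrak{F}$ with $\mathfrak{F}\not\vDash\varphi$.
   Context: $\mathcal{L}_{\forall\exists}$ is the propositional intuitionistic language ($\wedge,\vee,\to,\neg$) enriched with two unary modalities $\forall,\exists$. $\mathsf{MIPC}$ is the smallest set of $\mathcal{L}_{\forall\exists}$-formulas containing all axioms of intuitionistic propositional logic; the formulas $\forall p\to p$, $\forall p\to\forall\forall p$, $\forall(p\wedge q)\leftrightarrow(\forall p\wedge\forall q)$, $\forall(p\to q)\to(\forall p\to\forall q)$; the formulas $p\to\exists p$, $\exists\exists p\to\exists p$, $\exists(p\vee q)\leftrightarrow(\exists p\vee\exists q)$, $\exists(\exists p\wedge q)\leftrightarrow(\exists p\wedge\exists q)$, $\forall(p\to q)\to(\exists p\to\exists q)$; and $\exists p\to\forall\exists p$, $\exists\forall p\to\forall p$; and closed under substitution, modus ponens, and $\forall$-necessitation (from $\varphi$ infer $\forall\varphi$). $\mathsf{M^{+}IPC}$ is the smallest set of formulas containing $\mathsf{MIPC}$ and $\mathsf{MCas}:\ \forall((p\to\forall p)\to\forall p)\to\forall p$, closed under the same rules. An $\mathsf{MIPC}$-frame is $\mathfrak{F}=(W,R,E)$ with $(W,R)$ a nonempty partially ordered set and $E$ an equivalence relation on $W$ satisfying commutativity: if $xEy$ and $yRz$, then there is $w$ with $xRw$ and $wEz$. Define $xQy$ iff there is $z$ with $xRz$ and $zEy$.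 A valuation $\nu$ assigns to each propositional letter an $R$-upset of $W$. Truth: $w\vDash p$ iff $w\in\nu(p)$; $\wedge,\vee$ pointwise; $w\vDash\varphi\to\psi$ iff for all $v$ with $wRv$, $v\vDash\varphi$ implies $v\vDash\psi$; $w\vDash\neg\varphi$ iff $v\not\vDash\varphi$ for all $v$ with $wRv$; $w\vDash\forall\varphi$ iff $v\vDash\varphi$ for all $v$ with $wQv$; $w\vDash\exists\varphi$ iff $v\vDash\varphi$ for some $v$ with $wEv$. $\mathfrak{F}\vDash\varphi$ means $\varphi$ is true at all points under all valuations. An $\mathsf{M^{+}IPC}$-frame is an $\mathsf{MIPC}$-frame $\mathfrak{F}$ with $\mathfrak{F}\vDash\mathsf{MCas}$. *)

(* Defs.v *)
From Stdlib Require Import Relations FinFun.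

Inductive form : Type :=
| Var (n : nat)
| And (A B : form)
| Or (A B : form)
| Imp (A B : form)
| Neg (A : form)
| All (A : form)
| Ex (A : form).

Definition Iff (A B : form) : form := And (Imp A B) (Imp B A).

Fixpoint subst (s : nat -> form) (A : form) : form :=
  match A with
  | Var n => s n
  | And A B => And (subst s A) (subst s B)
  | Or A B => Or (subst s A) (subst s B)
  | Imp A B => Imp (subst s A) (subst s B)
  | Neg A => Neg (subst s A)
  | All A => All (subst s A)
  | Ex A => Ex (subst s A)
  end.

(* The axioms are single formulas in these fixed letters; their other instances
   are obtained through the substitution rule. *)
Local Notation p := (Var 0).
Local Notation q := (Var 1).
Local Notation r := (Var 2).
Local Infix "∧" := And (at level 40, left associativity).
Local Infix "∨" := Or (at level 50, left associativity).
Local Infix "⇒" := Imp (at level 60, right associativity).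
Local Infix "⇔" := Iff (at level 65, no associativity).

Inductive IPC_axiom : form -> Prop :=
| ax_K : IPC_axiom (p ⇒ q ⇒ p)
| ax_S : IPC_axiom ((p ⇒ q ⇒ r) ⇒ (p ⇒ q) ⇒ p ⇒ r)
| ax_and_l : IPC_axiom (p ∧ q ⇒ p)
| ax_and_r : IPC_axiom (p ∧ q ⇒ q)
| ax_and_i : IPC_axiom (p ⇒ q ⇒ p ∧ q)
| ax_or_l : IPC_axiom (p ⇒ p ∨ q)
| ax_or_r : IPC_axiom (q ⇒ p ∨ q)
| ax_or_e : IPC_axiom ((p ⇒ r) ⇒ (q ⇒ r) ⇒ p ∨ q ⇒ r)
| ax_neg_i : IPC_axiom ((p ⇒ q) ⇒ (p ⇒ Neg q) ⇒ Neg p)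
| ax_neg_e : IPC_axiom (Neg p ⇒ p ⇒ q).

Inductive MIPC_axiom : form -> Prop :=
| ax_IPC A : IPC_axiom A -> MIPC_axiom A
| ax_all_T : MIPC_axiom (All p ⇒ p)
| ax_all_4 : MIPC_axiom (All p ⇒ All (All p))
| ax_all_and : MIPC_axiom (All (p ∧ q) ⇔ All p ∧ All q)
| ax_all_K : MIPC_axiom (All (p ⇒ q) ⇒ All p ⇒ All q)
| ax_ex_T : MIPC_axiom (p ⇒ Ex p)
| ax_ex_4 : MIPC_axiom (Ex (Ex p) ⇒ Ex p)
| ax_ex_or : MIPC_axiom (Ex (p ∨ q) ⇔ Ex p ∨ Ex q)
| ax_ex_and : MIPC_axiom (Ex (Ex p ∧ q) ⇔ Ex p ∧ Ex q)
| ax_all_ex_K : MIPC_axiom (All (p ⇒ q) ⇒ Ex p ⇒ Ex q)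
| ax_ex_all_ex : MIPC_axiom (Ex p ⇒ All (Ex p))
| ax_ex_all : MIPC_axiom (Ex (All p) ⇒ All p).

Definition MCas : form := All ((p ⇒ All p) ⇒ All p) ⇒ All p.

(* The smallest set of formulas containing [Ax] and closed under substitution,
   modus ponens and necessitation for [All]. *)
Inductive closure (Ax : form -> Prop) : form -> Prop :=
| cl_ax A : Ax A -> closure Ax A
| cl_subst s A : closure Ax A -> closure Ax (subst s A)
| cl_mp A B : closure Ax (A ⇒ B) -> closure Ax A -> closure Ax B
| cl_nec A : closure Ax A -> closure Ax (All A).

Definition MIPC : form -> Prop := closure MIPC_axiom.

Definition MplusIPC : form -> Prop := closure (fun A => MIPC A \/ A = MCas).

Record MIPC_frame : Type := {
  world :> Type;
  R : relation world;
  E : relation world;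
  world_nonempty : inhabited world;
  R_order : order world R;
  E_equiv : equivalence world E;
  RE_comm : forall x y z : world, E x y -> R y z -> exists w, R x w /\ E w z
}.

Arguments R {m} x y.
Arguments E {m} x y.

Definition Q {F : MIPC_frame} (x y : F) : Prop := exists z, R x z /\ E z y.

Record valuation (F : MIPC_frame) : Type := {
  val :> nat -> F -> Prop;
  val_upset : forall n (w v : F), val n w -> R w v -> val n v
}.

Fixpoint truth {F : MIPC_frame} (nu : valuation F) (w : F) (A : form) : Prop :=
  match A with
  | Var n => nu n w
  | And A B => truth nu w A /\ truth nu w B
  | Or A B => truth nu w A \/ truth nu w B
  | Imp A B => forall v, R w v -> truth nu v A -> truth nu v B
  | Neg A => forall v, R w v -> ~ truth nu v A
  | All A => forall v, Q w v -> truth nu v A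
  | Ex A => exists v, E w v /\ truth nu v A
  end.

Definition valid (F : MIPC_frame) (A : form) : Prop :=
  forall (nu : valuation F) (w : F), truth nu w A.

Definition is_MplusIPC_frame (F : MIPC_frame) : Prop := valid F MCas.

(* Main.v *)
Require Import Defs.
From Stdlib Require Import FinFun.
From Stdlib Require Import Relations List Cantor Lia Classical ProofIrrelevance
  FunctionalExtensionality PropExtensionality IndefiniteDescription.
Import ListNotations.

(** In the canonical frame, whose points are the prime theories ordered by
    inclusion, the axiom MCas provides good refuters of universal formulas.  If
    [All A] is not in [T], then some prime theory [U] that is Q-above [T] omits
    [A] and contains [A ⇒ All A] ([canonical_stable_refuter]).  The formula
    [A ⇒ All A] persists upwards, so any [V] including [U] still omits [A],
    unless the cluster of [V] has come to contain [All A].  A refuter chosen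
    once for [A] therefore need not be chosen again until [All A] is true.

    This suggests describing a cluster by finitely many of its points, each with
    a name that records why it was chosen: [Ex A] for a witness of [A], and
    [All A] for a theory containing [A ⇒ All A].  Such a [sample] can be moved
    along R point by point, every name being kept, because clusters commute with
    inclusion ([canonical_lift]).  When an implication or a universal formula
    has to be refuted, one named point can moreover be prescribed
    ([sample_extend]).

    The finite frame forgets the theories and remembers which formulas of the
    finite set [sub phi] belong to each named point.  This is the [profile] of
    the sample, a subset of [sub phi × sub phi].  A point of the frame is a
    profile with one of its names, E is equality of profiles, and R is inclusion
    of profiles at a fixed name.  There are finitely many profiles.  Since R
    keeps the name and inclusion is antisymmetric, an R-step that Q can undo is
    an equality, and a finite frame with this property validates MCas ([finite_clean_MCas]).  In the truth
    lemma ([truth_profile]) any sample with the given profile may be used to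
    find the next one: the order only compares profiles, hence nothing has to be
    remembered along a path and no measure has to decrease. *)

Local Infix "∧" := And (at level 40, left associativity).
Local Infix "∨" := Or (at level 50, left associativity).
Local Infix "⇒" := Imp (at level 60, right associativity).

(** * Derivations from hypotheses *)

Definition letters (A B C : form) (n : nat) : form :=
  match n with 0 => A | 1 => B | _ => C end.

Lemma axiom_instance A B C X :
  MIPC_axiom X -> MplusIPC (subst (letters A B C) X).
Proof. intros H. apply cl_subst, cl_ax. left. now apply cl_ax. Qed.

Lemma MCas_instance A :
  MplusIPC (All ((A ⇒ All A) ⇒ All A) ⇒ All A).
Proof. apply (cl_subst _ (letters A A A) MCas), cl_ax. now right. Qed.

(** Necessitation and substitution act on theorems only: the deduction theorem
    would fail if they could be applied to hypotheses. *)
Inductive der (G : form -> Prop) : form -> Prop :=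
| der_thm A : MplusIPC A -> der G A
| der_hyp A : G A -> der G A
| der_mp A B : der G (A ⇒ B) -> der G A -> der G B.

Definition add (G : form -> Prop) (A B : form) : Prop := G B \/ B = A.

Lemma der_mono (G H : form -> Prop) A :
  (forall B, G B -> H B) -> der G A -> der H A.
Proof.
  intros GH D. induction D as [A hA | A hA | A B _ IHA _ IHB].
  - now apply der_thm.
  - apply der_hyp; auto.
  - exact (der_mp _ _ _ IHA IHB).
Qed.

Lemma der_K G A B : der G (A ⇒ B ⇒ A).
Proof. apply der_thm, (axiom_instance A B A _ (ax_IPC _ ax_K)). Qed.

Lemma der_S G A B C : der G ((A ⇒ B ⇒ C) ⇒ (A ⇒ B) ⇒ A ⇒ C).
Proof. apply der_thm, (axiom_instance A B C _ (ax_IPC _ ax_S)). Qed.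

Lemma deduction G A B : der (add G A) B -> der G (A ⇒ B).
Proof.
  intros D. induction D as [C hC | C [hC | ->] | C C' _ IH _ IH'].
  - eapply der_mp; [apply der_K | now apply der_thm].
  - eapply der_mp; [apply der_K | now apply der_hyp].
  - eapply der_mp; [eapply der_mp; [apply (der_S G A (A ⇒ A) A)|] |]; apply der_K.
  - eapply der_mp; [eapply der_mp; [apply der_S | exact IH] | exact IH'].
Qed.

Lemma der_last G A : der (add G A) A.
Proof. apply der_hyp. now right. Qed.

Lemma der_weak G A B : der G B -> der (add G A) B.
Proof. apply der_mono. now left. Qed.

Lemma der_empty A : der (fun _ => False) A -> MplusIPC A.
Proof.
  intros D. induction D as [A hA | A [] | A B _ IHA _ IHB]; auto.
  exact (cl_mp _ _ _ IHA IHB).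
Qed.

Lemma der_and G A B : der G A -> der G B -> der G (A ∧ B).
Proof.
  intros HA HB. eapply der_mp; [eapply der_mp; [|exact HA] | exact HB].
  apply der_thm, (axiom_instance A B A _ (ax_IPC _ ax_and_i)).
Qed.

Lemma der_and_l G A B : der G (A ∧ B) -> der G A.
Proof.
  apply der_mp, der_thm, (axiom_instance A B A _ (ax_IPC _ ax_and_l)).
Qed.

Lemma der_and_r G A B : der G (A ∧ B) -> der G B.
Proof.
  apply der_mp, der_thm, (axiom_instance A B A _ (ax_IPC _ ax_and_r)).
Qed.

Lemma der_or_l G A B : der G A -> der G (A ∨ B).
Proof.
  apply der_mp, der_thm, (axiom_instance A B A _ (ax_IPC _ ax_or_l)).
Qed.

Lemma der_or_r G A B : der G B -> der G (A ∨ B).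
Proof.
  apply der_mp, der_thm, (axiom_instance A B A _ (ax_IPC _ ax_or_r)).
Qed.

Lemma der_or_elim G A B C :
  der G (A ∨ B) -> der (add G A) C -> der (add G B) C -> der G C.
Proof.
  intros HAB HA HB. apply deduction in HA, HB.
  refine (der_mp _ _ _ (der_mp _ _ _ (der_mp _ _ _ _ HA) HB) HAB).
  apply der_thm, (axiom_instance A B C _ (ax_IPC _ ax_or_e)).
Qed.

Lemma der_all_4 G A : der G (All A) -> der G (All (All A)).
Proof. apply der_mp, der_thm, (axiom_instance A A A _ ax_all_4). Qed.

Lemma der_all_mono G A B : MplusIPC (A ⇒ B) -> der G (All A) -> der G (All B).
Proof.
  intros H. apply der_mp. apply (der_mp _ (All (A ⇒ B))).
  - apply der_thm, (axiom_instance A B A _ ax_all_K).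
  - now apply der_thm, cl_nec.
Qed.

(** * Prime theories *)

Definition theory (T : form -> Prop) : Prop := forall A, der T A -> T A.

Definition prime (T : form -> Prop) : Prop :=
  theory T /\ (forall A B, T (A ∨ B) -> T A \/ T B) /\ exists A, ~ T A.

Section TheoryFacts.
Context (T : form -> Prop) (hT : theory T).

Lemma theory_thm A : MplusIPC A -> T A.
Proof. intros H. apply hT. now apply der_thm. Qed.

Lemma theory_mp A B : T (A ⇒ B) -> T A -> T B.
Proof. intros HAB HA. apply hT. eapply der_mp; apply der_hyp; eassumption. Qed.

Lemma theory_by A B : MplusIPC (A ⇒ B) -> T A -> T B.
Proof. intros H. now apply theory_mp, theory_thm. Qed.

Lemma theory_and A B : T (A ∧ B) <-> T A /\ T B.
Proof.
  split.
  - intros H. split; apply hT; [eapply der_and_l | eapply der_and_r];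
      apply der_hyp, H.
  - intros [HA HB]. apply hT, der_and; now apply der_hyp.
Qed.

Lemma theory_or A B : T A \/ T B -> T (A ∨ B).
Proof.
  intros [H | H]; apply hT; [apply der_or_l | apply der_or_r]; now apply der_hyp.
Qed.

Lemma theory_neg A B : T (Neg A) -> T A -> T B.
Proof.
  intros HN. apply theory_mp. revert HN. apply theory_by.
  apply (axiom_instance A B A _ (ax_IPC _ ax_neg_e)).
Qed.

Lemma theory_neg_intro A : T (A ⇒ Neg A) -> T (Neg A).
Proof.
  intros H. apply (theory_mp (A ⇒ Neg A)); [|exact H].
  apply (theory_mp (A ⇒ A)).
  - apply theory_thm, (axiom_instance A A A _ (ax_IPC _ ax_neg_i)).
  - apply hT, deduction, der_last.
Qed.

Lemma theory_all_T A : T (All A) -> T A.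
Proof. apply theory_by, (axiom_instance A A A _ ax_all_T). Qed.

Lemma theory_all_4 A : T (All A) -> T (All (All A)).
Proof. intros H. now apply hT, der_all_4, der_hyp. Qed.

Lemma theory_all_K A B : T (All (A ⇒ B)) -> T (All A) -> T (All B).
Proof.
  intros H. apply theory_mp. revert H.
  apply theory_by, (axiom_instance A B A _ ax_all_K).
Qed.

Lemma theory_ex_T A : T A -> T (Ex A).
Proof. apply theory_by, (axiom_instance A A A _ ax_ex_T). Qed.

Lemma theory_ex_mono A B : T (All (A ⇒ B)) -> T (Ex A) -> T (Ex B).
Proof.
  intros H. apply theory_mp. revert H.
  apply theory_by, (axiom_instance A B A _ ax_all_ex_K).
Qed.

Lemma theory_ex_by A B : MplusIPC (A ⇒ B) -> T (Ex A) -> T (Ex B).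
Proof. intros H. now apply theory_ex_mono, theory_thm, cl_nec. Qed.

Lemma theory_all_ex A : T (Ex A) -> T (All (Ex A)).
Proof. apply theory_by, (axiom_instance A A A _ ax_ex_all_ex). Qed.

Lemma theory_ex_all A : T (Ex (All A)) -> T (All A).
Proof. apply theory_by, (axiom_instance A A A _ ax_ex_all). Qed.

Lemma theory_ex_and A B : T (Ex A) -> T (Ex B) -> T (Ex (Ex A ∧ B)).
Proof.
  intros HA HB. apply (theory_mp (Ex A ∧ Ex B)); [|now apply theory_and].
  pose proof (theory_thm _ (axiom_instance A B A _ ax_ex_and)) as H.
  now apply theory_and in H.
Qed.

Lemma theory_all_and A B : T (All A) -> T (All B) -> T (All (A ∧ B)).
Proof.
  intros HA HB. apply (theory_mp (All A ∧ All B)); [|now apply theory_and].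
  pose proof (theory_thm _ (axiom_instance A B A _ ax_all_and)) as H.
  now apply theory_and in H.
Qed.

(** Necessitation under hypotheses: a proof from formulas whose boxes are in [T]
    can be boxed step by step. *)
Lemma der_boxed A : der (fun B => T (All B)) A -> T (All A).
Proof.
  intros D. induction D as [A hA | A hA | A B _ IH _ IH'].
  - now apply theory_thm, cl_nec.
  - exact hA.
  - eapply theory_all_K; eassumption.
Qed.

End TheoryFacts.

(** * Lindenbaum's lemma *)

Fixpoint code (A : form) : nat :=
  match A with
  | Var n => to_nat (0, n)
  | And A B => to_nat (1, to_nat (code A, code B))
  | Or A B => to_nat (2, to_nat (code A, code B))
  | Imp A B => to_nat (3, to_nat (code A, code B))
  | Neg A => to_nat (4, code A)
  | All A => to_nat (5, code A)
  | Ex A => to_nat (6, code A)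
  end.

Lemma to_nat_pair_inj a b c d : to_nat (a, b) = to_nat (c, d) -> a = c /\ b = d.
Proof. intros H. apply to_nat_inj in H. now injection H. Qed.

Lemma code_inj A B : code A = code B -> A = B.
Proof.
  revert B. induction A; intros [] H; cbn [code] in H;
    apply to_nat_pair_inj in H; destruct H as [H0 H]; try discriminate H0;
    try (apply to_nat_pair_inj in H; destruct H); f_equal; auto.
Qed.

Section Lindenbaum.
Context (G N : form -> Prop).
Context (N_or : forall A B, N A -> N B -> N (A ∨ B)).
Context (N_ex : exists A, N A).
Context (G_avoids : forall A, der G A -> ~ N A).

(** Formulas are treated in the order of [code], which is injective but not
    onto; at a number that is no code the stage is unchanged. *)
Definition addable (S : form -> Prop) (B : form) : Prop :=
  forall A, der (add S B) A -> ~ N A.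

Fixpoint stage (n : nat) : form -> Prop :=
  match n with
  | 0 => G
  | S n => fun B => stage n B \/ (code B = n /\ addable (stage n) B)
  end.

Lemma stage_avoids n A : der (stage n) A -> ~ N A.
Proof.
  revert A. induction n as [|n IH]; [exact G_avoids|].
  intros A D. cbn in D.
  destruct (classic (exists B, code B = n /\ addable (stage n) B))
    as [(B & eB & HB) | none].
  - apply HB. revert D. apply der_mono. intros C [HC | [eC _]].
    + now left.
    + right. apply code_inj. congruence.
  - apply IH. revert D. apply der_mono. intros C [HC | HC]; [exact HC|].
    destruct none. eauto.
Qed.

Lemma stage_mono n m A : n <= m -> stage n A -> stage m A.
Proof. induction 1; [auto | now left; auto]. Qed.

Lemma der_limit A :
  der (fun B => exists n, stage n B) A -> exists n, der (stage n) A.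
Proof.
  intros D. induction D as [A hA | A [n hA] | A B _ [n IH] _ [m IH']].
  - exists 0. now apply der_thm.
  - exists n. now apply der_hyp.
  - exists (max n m). apply (der_mp _ A).
    + revert IH. apply der_mono. intros C. apply stage_mono. lia.
    + revert IH'. apply der_mono. intros C. apply stage_mono. lia.
Qed.

(** Closure of [N] under disjunction gives primeness: if neither [A] nor [B] can
    be added, they lead to [X] and [Y] in [N], and then [A ∨ B] leads to
    [X ∨ Y]. *)
Lemma lindenbaum :
  exists T, prime T /\ (forall A, G A -> T A) /\ (forall A, T A -> ~ N A).
Proof.
  pose (T := fun B => exists n, stage n B).
  assert (avoid : forall A, der T A -> ~ N A).
  { intros A D. destruct (der_limit _ D) as [n Hn].
    exact (stage_avoids n A Hn). }
  assert (out : forall B, ~ T B -> exists A, der (add T B) A /\ N A).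
  { intros B nB. apply NNPP. intros none. apply nB. exists (S (code B)).
    right. split; [reflexivity|]. intros A D HA. apply none. exists A.
    split; [|exact HA]. revert D. apply der_mono.
    intros C [HC | ->]; [left; now exists (code B) | now right]. }
  assert (closed : theory T).
  { intros B D. apply NNPP. intros nB. destruct (out B nB) as (A & HA & NA).
    apply (avoid A); [|exact NA].
    exact (der_mp _ _ _ (deduction _ _ _ HA) D). }
  exists T. split; [|split].
  - split; [exact closed | split].
    + intros A B HAB. apply NNPP. intros nAB.
      destruct (out A) as (X & DX & NX); [tauto|].
      destruct (out B) as (Y & DY & NY); [tauto|].
      apply (avoid (X ∨ Y)); [|now apply N_or].
      apply (der_or_elim _ A B); [now apply der_hyp | |].
      * now apply der_or_l.
      * now apply der_or_r.
    + destruct N_ex as [A NA]. exists A. intros HA.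
      exact (avoid A (der_hyp _ _ HA) NA).
  - intros A HA. now exists 0.
  - intros A HA. now apply avoid, der_hyp.
Qed.
End Lindenbaum.

Lemma prime_extension G A :
  ~ der G A -> exists T, prime T /\ (forall B, G B -> T B) /\ ~ T A.
Proof.
  intros nA.
  destruct (lindenbaum G (fun B => MplusIPC (B ⇒ A))) as (T & pT & GT & NT).
  - intros B C HB HC. apply der_empty, deduction.
    apply (der_or_elim _ B C); [apply der_last | |].
    + exact (der_mp _ _ _ (der_thm _ _ HB) (der_last _ _)).
    + exact (der_mp _ _ _ (der_thm _ _ HC) (der_last _ _)).
  - exists A. apply der_empty, deduction, der_last.
  - intros B D HB. apply nA. exact (der_mp _ _ _ (der_thm _ _ HB) D).
  - exists T. split; [exact pT | split; [exact GT|]]. intros HA.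
    apply (NT A HA). apply der_empty, deduction, der_last.
Qed.

(** * The canonical frame *)

(** Canonical counterpart of Q. *)
Definition sees (T U : form -> Prop) : Prop := forall A, T (All A) -> U A.

(** Canonical counterpart of E.  Existential formulas are not mentioned because
    [Ex A] and [All (Ex A)] are equivalent. *)
Definition cluster (T U : form -> Prop) : Prop :=
  forall A, T (All A) <-> U (All A).

Lemma cluster_ex T U A :
  theory T -> theory U -> cluster T U -> T (Ex A) -> U (Ex A).
Proof.
  intros hT hU TU H. apply theory_all_T, TU, theory_all_ex; assumption.
Qed.

(** The formulas to avoid are those implying some [All A] outside [U].  They are
    closed under disjunction: [All A ∨ All A'] implies its own box, which is
    again outside the prime theory [U]. *)
Lemma prime_extension_in_cluster G U :
  prime U ->
  (forall A, U (All A) -> G (All A)) ->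
  (forall A, der G (All A) -> U (All A)) ->
  exists T, prime T /\ (forall A, G A -> T A) /\ cluster T U.
Proof.
  intros (hU & U_or & [C nC]) HG HU.
  destruct (lindenbaum G (fun B => exists A, MplusIPC (B ⇒ All A) /\ ~ U (All A)))
    as (T & pT & GT & NT).
  - intros B B' (A & HB & nA) (A' & HB' & nA').
    exists (All A ∨ All A'). split.
    + apply der_empty, deduction.
      apply (der_or_elim _ B B'); [apply der_last | |].
      * apply (der_all_mono _ (All A)).
        -- apply der_empty, deduction, der_or_l, der_last.
        -- apply der_all_4. exact (der_mp _ _ _ (der_thm _ _ HB) (der_last _ _)).
      * apply (der_all_mono _ (All A')).
        -- apply der_empty, deduction, der_or_r, der_last.
        -- apply der_all_4. exact (der_mp _ _ _ (der_thm _ _ HB') (der_last _ _)).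
    + intros H. apply theory_all_T in H; [|exact hU].
      apply U_or in H. tauto.
  - exists (All C), C. split; [apply der_empty, deduction, der_last|].
    intros H. now apply nC, theory_all_T.
  - intros B D (A & HB & nA). apply nA, HU.
    exact (der_mp _ _ _ (der_thm _ _ HB) D).
  - exists T. split; [exact pT | split; [exact GT|]]. intros A. split.
    + intros HA. apply NNPP. intros nA. apply (NT _ HA).
      exists A. split; [apply der_empty, deduction, der_last | exact nA].
    + auto.
Qed.

Lemma canonical_imp T A B :
  prime T -> ~ T (A ⇒ B) ->
  exists U, prime U /\ (forall C, T C -> U C) /\ U A /\ ~ U B.
Proof.
  intros (hT & _) nAB.
  destruct (prime_extension (add T A) B) as (U & pU & TU & nB).
  - intros D. now apply nAB, hT, deduction.
  - exists U. split; [exact pU|]. split; [now intros C HC; apply TU; left|].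
    split; [now apply TU; right | exact nB].
Qed.

Lemma canonical_all T A :
  prime T -> ~ T (All A) -> exists U, prime U /\ sees T U /\ ~ U A.
Proof.
  intros (hT & _) nA. apply (prime_extension (fun B => T (All B))).
  intros D. now apply nA, der_boxed.
Qed.

(** If the boxed part of [T] with [A] proved some [All B], then [T] would contain
    [All (A ⇒ All B)], so [Ex A] would give [Ex (All B)], hence [All B]. *)
Lemma canonical_ex T A :
  prime T -> T (Ex A) -> exists U, prime U /\ cluster U T /\ U A.
Proof.
  intros pT HA. pose proof pT as [hT _].
  destruct (prime_extension_in_cluster (add (fun B => T (All B)) A) T)
    as (U & pU & GU & UT).
  - exact pT.
  - intros B HB. left. now apply theory_all_4.
  - intros B D. apply deduction, der_boxed in D; [|exact hT].
    apply theory_ex_all; [exact hT|].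
    exact (theory_ex_mono _ hT _ _ D HA).
  - exists U. split; [exact pU | split; [exact UT|]]. apply GU. now right.
Qed.

(** This gives both the commutativity condition and the factorisation of Q as R
    followed by E.  For consistency, suppose that [T] with the boxed part of [U]
    proves [All A].  Some [All B] in [U] then has [All B ⇒ All A] in [T], so
    [Ex (All B ⇒ All A)] is in [T] and passes to [U].  There the axiom for [Ex]
    and conjunction combines it with [All B] into [Ex (All A)]. *)
Lemma canonical_lift T U :
  prime T -> prime U -> sees T U ->
  exists V, prime V /\ (forall A, T A -> V A) /\ cluster V U.
Proof.
  intros (hT & _) pU TU. pose proof pU as [hU _].
  destruct (prime_extension_in_cluster
              (fun A => T A \/ exists B, A = All B /\ U (All B)) U)
    as (V & pV & GV & VU).
  - exact pU.
  - eauto.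
  - intros A D.
    assert (compact : exists B, U (All B) /\ T (All B ⇒ All A)).
    { induction D as [C hC | C [hC | (B & -> & HB)]
                     | C C' _ (B & HB & IH) _ (B' & HB' & IH')].
      (* Any boxed theorem serves as [B] when none is used. *)
      - exists (C ⇒ C). split.
        + apply theory_thm; [exact hU|].
          apply cl_nec, der_empty, deduction, der_last.
        + now apply hT, deduction, der_thm.
      - exists (C ⇒ C). split.
        + apply theory_thm; [exact hU|].
          apply cl_nec, der_empty, deduction, der_last.
        + now apply hT, deduction, der_weak, der_hyp.
      - exists B. split; [exact HB|]. apply hT, deduction, der_last.
      - exists (B ∧ B'). split; [now apply theory_all_and|].
        assert (step : forall X Y Z, MplusIPC (X ⇒ Y) -> T (All Y ⇒ Z) ->
                                     der (add T (All X)) Z).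
        { intros X Y Z HXY HYZ.
          eapply der_mp; [apply der_weak, der_hyp, HYZ|].
          apply (der_all_mono _ X); [exact HXY | apply der_last]. }
        apply hT, deduction. apply (der_mp _ C).
        + apply (step _ B); [|exact IH].
          apply der_empty, deduction, (der_and_l _ _ B'), der_last.
        + apply (step _ B'); [|exact IH'].
          apply der_empty, deduction, (der_and_r _ B), der_last. }
    destruct compact as (B & HB & HBA).
    apply theory_ex_all; [exact hU|].
    assert (HE : U (Ex (All B ⇒ All A))).
    { apply TU, theory_all_ex; [exact hT|]. now apply theory_ex_T. }
    apply (theory_ex_by _ hU (Ex (All B) ∧ (All B ⇒ All A))).
    + apply der_empty, deduction.
      eapply der_mp; [eapply der_and_r, der_last|].
      eapply der_mp; [apply der_thm, (axiom_instance B B B _ ax_ex_all)|].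
      eapply der_and_l, der_last.
    + apply theory_ex_and; [exact hU | | exact HE]. now apply theory_ex_T.
  - exists V. auto.
Qed.

(** MCas is used here and nowhere else.  As [All A] is not in [T], neither is
    [All ((A ⇒ All A) ⇒ All A)]; refute that box, then the implication under
    it. *)
Lemma canonical_stable_refuter T A :
  prime T -> ~ T (All A) ->
  exists U, prime U /\ sees T U /\ U (A ⇒ All A) /\ ~ U A.
Proof.
  intros pT nA. pose proof pT as [hT _].
  destruct (canonical_all T ((A ⇒ All A) ⇒ All A) pT) as (V & pV & TV & nV).
  { intros H. apply nA. revert H. apply theory_by, MCas_instance; exact hT. }
  destruct (canonical_imp _ _ _ pV nV) as (U & pU & VU & HU & nU).
  exists U. split; [exact pU|]. split; [now intros B HB; apply VU, TV|].
  split; [exact HU|]. intros H. apply nU. destruct pU as [hU _].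
  exact (theory_mp _ hU _ _ HU H).
Qed.

(** * The relevant formulas *)

(** Subformulas, together with [A ⇒ All A] for each [All A]: the profiles must
    see the formula that makes a refuter of [A] persistent. *)
Fixpoint sub (A : form) : list form :=
  A :: match A with
       | Var _ => []
       | And A B | Or A B | Imp A B => sub A ++ sub B
       | Neg A | Ex A => sub A
       | All A => (A ⇒ All A) :: sub A
       end.

Lemma sub_self A : In A (sub A).
Proof. destruct A; now left. Qed.

Lemma sub_trans A B C : In B (sub A) -> In C (sub B) -> In C (sub A).
Proof.
  revert B. induction A; intros D [<- | HD] HC; try exact HC; try contradiction;
    cbn [sub];
    try (right; apply in_app_iff in HD; apply in_app_iff; destruct HD; eauto; fail);
    try (right; eauto; fail).
  destruct HD as [<- | HD]; [|right; right; eauto].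
  destruct HC as [<- | HC]; [now right; left|].
  apply in_app_iff in HC. destruct HC as [HC | HC]; [right; right|]; assumption.
Qed.

(** * MCas in finite frames *)

Lemma finite_maximal {X : Type} (lt : X -> X -> Prop) (P : X -> Prop) (l : list X) :
  (forall x y z, lt x y -> lt y z -> lt x z) ->
  (forall x, ~ lt x x) ->
  (exists x, In x l /\ P x) ->
  exists x, P x /\ forall y, In y l -> P y -> ~ lt x y.
Proof.
  intros trans irrefl. induction l as [|a l IH]; [now intros (x & [] & _)|].
  intros ex. destruct (classic (exists x, In x l /\ P x)) as [some | none].
  - destruct (IH some) as (m & Pm & max).
    destruct (classic (P a /\ lt m a)) as [[Pa ma] | no].
    + exists a. split; [exact Pa|]. intros y [<- | Hy] Py ay.
      * exact (irrefl _ ay).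
      * apply (max y Hy Py). eauto.
    + exists m. split; [exact Pm|]. intros y [<- | Hy] Py; auto.
  - destruct ex as (x & [<- | Hx] & Px); [|now destruct none; exists x].
    exists a. split; [exact Px|]. intros y [<- | Hy] Py; [apply irrefl|].
    destruct none. eauto.
Qed.

Lemma Q_refl (F : MIPC_frame) (x : F) : Q x x.
Proof.
  exists x. split; [apply (ord_refl _ _ (R_order F))|].
  apply (equiv_refl _ _ (E_equiv F)).
Qed.

Lemma Q_trans (F : MIPC_frame) (x y z : F) : Q x y -> Q y z -> Q x z.
Proof.
  intros (x' & xx' & x'y) (y' & yy' & y'z).
  destruct (RE_comm F _ _ _ x'y yy') as (w & x'w & wy').
  exists w. split.
  - exact (ord_trans _ _ (R_order F) _ _ _ xx' x'w).
  - exact (equiv_trans _ _ (E_equiv F) _ _ _ wy' y'z).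
Qed.

Lemma Q_of_R (F : MIPC_frame) (x y : F) : R x y -> Q x y.
Proof.
  intros xy. exists y. split; [exact xy | apply (equiv_refl _ _ (E_equiv F))].
Qed.

(** Let [m] be a Q-maximal refuter of the letter [p].  It satisfies [p ⇒ All p]:
    if an R-successor of [m] satisfied [p] and saw a refuter of [p], this refuter
    would see [m] by maximality, so the successor would be [m] itself.  The
    premise of MCas then yields [All p] at [m]. *)
Lemma finite_clean_MCas (F : MIPC_frame) :
  Finite F -> (forall x y : F, R x y -> Q y x -> x = y) -> is_MplusIPC_frame F.
Proof.
  intros [l full] clean nu w v _ Hv x0 vx0. cbn [truth] in *.
  apply NNPP. intros nx0.
  destruct (finite_maximal (fun x y => Q x y /\ ~ Q y x)
              (fun x => Q v x /\ ~ nu 0 x) l) as (m & [vm nm] & max).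
  - intros x y z [xy nyx] [yz nzy]. split; [exact (Q_trans _ _ _ _ xy yz)|].
    intros zx. apply nyx. exact (Q_trans _ _ _ _ yz zx).
  - intros x [xx nxx]. contradiction.
  - exists x0. auto.
  - apply nm. refine (Hv m vm m (ord_refl _ _ (R_order F) m) _ m (Q_refl F m)).
    intros u mu Hu t ut. apply NNPP. intros nt.
    pose proof (Q_trans _ _ _ _ (Q_of_R _ _ _ mu) ut) as mt.
    assert (tm : Q t m).
    { apply NNPP. intros ntm. apply (max t (full t)); [|now split].
      split; [exact (Q_trans _ _ _ _ vm mt) | exact nt]. }
    apply nm. now rewrite (clean m u mu (Q_trans _ _ _ _ ut tm)).
Qed.

(** * Finiteness of the set of profiles *)

(** Subsets are propositional predicates, so they can only be listed up to
    extensionality. *)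
Lemma finite_subsets {X : Type} (l : list X) :
  exists L : list (X -> Prop), forall P, (forall x, P x -> In x l) -> In P L.
Proof.
  induction l as [|a l [L HL]].
  - exists [fun _ => False]. intros P HP. left. apply functional_extensionality.
    intros x. apply propositional_extensionality. split; [contradiction | apply HP].
  - exists (L ++ map (fun P x => P x \/ x = a) L). intros P HP. apply in_app_iff.
    destruct (classic (P a)) as [Pa | nPa].
    + right. apply in_map_iff. exists (fun x => P x /\ x <> a). split.
      * apply functional_extensionality. intros x.
        apply propositional_extensionality.
        destruct (classic (x = a)) as [-> | ne]; tauto.
      * apply HL. intros x [Px ne]. now destruct (HP x Px) as [<- | Hx].
    + left. apply HL. intros x Px. now destruct (HP x Px) as [<- | Hx].
Qed.

Lemma finite_sig {X : Type} (P : X -> Prop) (l : list X) :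
  (forall x, P x -> In x l) -> Finite {x | P x}.
Proof.
  intros HP. enough (exists l', forall s : {x | P x}, In (proj1_sig s) l -> In s l')
    as [l' Hl'] by (exists l'; intros [x Px]; now apply Hl', HP).
  clear HP. induction l as [|a l [l' IH]]; [now exists []|].
  destruct (classic (P a)) as [Pa | nPa].
  - exists (exist _ a Pa :: l'). intros [x Px] [e | Hx]; [left | right; now apply IH].
    cbn in e. subst. f_equal. apply proof_irrelevance.
  - exists l'. intros [x Px] [e | Hx]; [|now apply IH]. cbn in e. now subst.
Qed.

(** * Samples of canonical clusters *)

Section Profiles.
Context (phi : form).

(** The reason for which a point is named [i].  Both reasons are inherited by
    larger theories, so a point can be moved upwards under the same name.
    For [All A] it is not required that [A] be omitted, since this is lost once
    [All A] becomes true. *)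
Definition fits (i : form) (T : form -> Prop) : Prop :=
  (exists A, i = Ex A /\ T A) \/ (exists A, i = All A /\ T (A ⇒ All A)).

(** [D] is the set of names in use and [a] assigns theories to them.  The last
    field says that existential formulas true in the cluster have their
    witnesses among the named points. *)
Record sample (D : form -> Prop) (a : form -> form -> Prop) : Prop := {
  sample_index i : D i -> In i (sub phi);
  sample_prime i : D i -> prime (a i);
  sample_fits i : D i -> fits i (a i);
  sample_cluster i j : D i -> D j -> cluster (a i) (a j);
  sample_ex i A : D i -> In (Ex A) (sub phi) -> a i (Ex A) -> D (Ex A)
}.

(** Moving a sample to the cluster of [T], with [T] itself placed at the name
    [k]: points already named are lifted, and the names [Ex A] that become
    necessary in the new cluster are added. *)
Lemma sample_extend D a T k :
  sample D a -> prime T -> (forall i, D i -> sees (a i) T) ->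
  In k (sub phi) -> fits k T -> (D k -> forall A, a k A -> T A) ->
  exists D' b, sample D' b /\ D' k /\ b k = T /\
    forall i, D i -> D' i /\ forall A, a i A -> b i A.
Proof.
  intros sm pT see ksub kfit kT. pose proof pT as [hT _].
  pose (D' := fun i => D i \/ i = k \/
    (In i (sub phi) /\ exists A, i = Ex A /\ T (Ex A))).
  destruct (functional_choice (fun i U => D' i ->
      prime U /\ cluster U T /\ fits i U /\ (i = k -> U = T) /\
      (D i -> forall A, a i A -> U A))) as [b Hb].
  { intros i. destruct (classic (i = k)) as [-> | ik].
    - exists T. intros _. split; [exact pT|]. now split.
    - destruct (classic (D i)) as [Di | nDi].
      + destruct (canonical_lift (a i) T) as (U & pU & aU & UT); auto.
        { apply (sample_prime _ _ sm i Di). }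
        exists U. intros _. split; [exact pU|]. split; [exact UT|].
        split; [|now split].
        destruct (sample_fits _ _ sm i Di) as [(A & e & HA) | (A & e & HA)];
          [left | right]; eauto.
      + destruct (classic (D' i)) as [D'i | nD'i]; [|now exists T].
        destruct D'i as [Di | [e | (isub & A & -> & HA)]]; try contradiction.
        destruct (canonical_ex T A pT HA) as (U & pU & UT & HU).
        exists U. intros _. split; [exact pU|]. split; [exact UT|].
        split; [left; eauto | now split]. }
  exists D', b. split; [constructor|split; [|split]].
  - intros i [Di | [-> | [isub _]]]; auto. apply (sample_index _ _ sm i Di).
  - intros i Di. apply Hb, Di.
  - intros i Di. apply Hb, Di.
  - intros i j Di Dj A. destruct (Hb i Di) as (_ & Ci & _).
    destruct (Hb j Dj) as (_ & Cj & _). now rewrite (Ci A), (Cj A).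
  - intros i A Di Asub HA. right. right. split; [exact Asub|]. exists A.
    split; [reflexivity|]. destruct (Hb i Di) as ([hU _] & Ci & _).
    exact (cluster_ex _ _ _ hU hT Ci HA).
  - right. now left.
  - apply Hb; [right; now left | reflexivity].
  - intros i Di. assert (D'i : D' i) by now left.
    split; [exact D'i|]. now apply Hb.
Qed.

(** * The frame of profiles *)

Definition profile (D : form -> Prop) (a : form -> form -> Prop) (x : form * form)
  : Prop := D (fst x) /\ In (snd x) (sub phi) /\ a (fst x) (snd x).

Definition is_point (w : (form * form -> Prop) * form) : Prop :=
  exists D a, sample D a /\ fst w = profile D a /\ D (snd w).

Definition point : Type := {w | is_point w}.

Definition prof (x : point) : form * form -> Prop := fst (proj1_sig x).
Definition idx (x : point) : form := snd (proj1_sig x).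

Lemma point_ext (x y : point) : prof x = prof y -> idx x = idx y -> x = y.
Proof.
  destruct x as [[X i] hx], y as [[Y j] hy]. cbn. intros e1 e2.
  unfold prof, idx in *. cbn in *. subst. f_equal. apply proof_irrelevance.
Qed.

(** Every name in use has a formula in its profile, namely the one that [fits]
    provides.  Inclusion of profiles hence entails inclusion of the sets of
    names. *)
Lemma profile_live D a i : sample D a -> (D i <-> exists A, profile D a (i, A)).
Proof.
  intros sm. split; [|now intros (A & Di & _)].
  intros Di. pose proof (sample_index _ _ sm i Di) as isub.
  destruct (sample_fits _ _ sm i Di) as [(A & -> & HA) | (A & -> & HA)].
  - exists A. repeat split; auto. apply (sub_trans _ _ _ isub).
    right. apply sub_self.
  - exists (A ⇒ All A). repeat split; auto. apply (sub_trans _ _ _ isub).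
    right. now left.
Qed.

Lemma point_live (x : point) : exists A, prof x (idx x, A).
Proof.
  destruct x as [w (D & a & sm & e & Di)]. unfold prof, idx. cbn.
  rewrite e. now apply profile_live.
Qed.

Definition leq (X Y : form * form -> Prop) : Prop := forall z, X z -> Y z.

Definition point_R (x y : point) : Prop := leq (prof x) (prof y) /\ idx x = idx y.
Definition point_E (x y : point) : Prop := prof x = prof y.

Lemma leq_antisym X Y : leq X Y -> leq Y X -> X = Y.
Proof.
  intros XY YX. apply functional_extensionality. intros z.
  apply propositional_extensionality. split; auto.
Qed.

Lemma point_R_order : order point point_R.
Proof.
  constructor.
  - intros x. now split.
  - intros x y z [xy e] [yz e']. split; [intros t Ht; auto | congruence].
  - intros x y [xy e] [yx _]. apply point_ext; [now apply leq_antisym | exact e].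
Qed.

Lemma point_E_equiv : equivalence point point_E.
Proof. constructor; congruence. Qed.

Lemma point_reindex (x y : point) :
  leq (prof x) (prof y) -> exists w : point, prof w = prof y /\ idx w = idx x.
Proof.
  intros xy. destruct (point_live x) as [A HA]. apply xy in HA.
  destruct y as [w (D & a & sm & e & Di)]. unfold prof in *. cbn in *.
  assert (pw : is_point (fst w, idx x)).
  { exists D, a. split; [exact sm|]. split; [exact e|].
    rewrite e in HA. apply HA. }
  now exists (exist _ _ pw).
Qed.

Lemma point_RE_comm (x y z : point) :
  point_E x y -> point_R y z -> exists w, point_R x w /\ point_E w z.
Proof.
  intros xy [yz _]. destruct (point_reindex x z) as (w & wz & wx).
  - now rewrite xy.
  - exists w. split; [|exact wz]. split; [|now symmetry]. now rewrite wz, xy.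
Qed.

Lemma sample_point D a i :
  sample D a -> D i -> exists x : point, prof x = profile D a /\ idx x = i.
Proof.
  intros sm Di. assert (pw : is_point (profile D a, i)) by (exists D, a; auto).
  now exists (exist _ _ pw).
Qed.

Lemma point_sample (x : point) :
  exists D a, sample D a /\ D (idx x) /\ prof x = profile D a.
Proof. destruct x as [w (D & a & sm & e & Di)]. exists D, a. auto. Qed.

(** The hypothesis speaks of the theories and not of the profile because negation
    is treated as the case where [B] is [Neg A], and [A ⇒ Neg A] need not be in
    [sub phi]. *)
Lemma point_refutes_imp (x : point) A B :
  In A (sub phi) ->
  (forall D a, sample D a -> D (idx x) -> prof x = profile D a ->
     ~ a (idx x) (A ⇒ B)) ->
  exists y, point_R x y /\ prof y (idx y, A) /\ ~ prof y (idx y, B).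
Proof.
  intros sA ref. destruct (point_sample x) as (D & a & sm & Di & e).
  set (i := idx x) in *.
  destruct (canonical_imp (a i) A B (sample_prime _ _ sm i Di) (ref D a sm Di e))
    as (T & pT & iT & HA & nB).
  destruct (sample_extend D a T i sm pT) as (D' & b & sm' & D'i & bi & ext).
  - intros j Dj C HC. apply theory_all_T; [apply pT|]. apply iT.
    now apply (sample_cluster _ _ sm j i).
  - apply (sample_index _ _ sm i Di).
  - destruct (sample_fits _ _ sm i Di) as [(C & eC & HC) | (C & eC & HC)];
      [left | right]; eauto.
  - auto.
  - destruct (sample_point D' b i sm' D'i) as (y & ey & iy). exists y.
    split; [split|].
    + rewrite e, ey. intros [j C] (Dj & sC & HC). cbn [fst snd] in *.
      destruct (ext j Dj) as [D'j ab]. split; [exact D'j|]. split; [exact sC|].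
      now apply ab.
    + now symmetry.
    + rewrite ey, iy. unfold profile. cbn [fst snd]. rewrite bi. tauto.
Qed.

(** If the name [All A] is in use, its point is a refuter in the present cluster.
    Otherwise MCas gives one in a cluster above, to be named [All A]. *)
Lemma point_refutes_all (x : point) A :
  In (All A) (sub phi) -> ~ prof x (idx x, All A) ->
  exists y, leq (prof x) (prof y) /\ ~ prof y (idx y, A).
Proof.
  intros sA nx. destruct (point_sample x) as (D & a & sm & Di & e).
  set (i := idx x) in *. rewrite e in nx.
  assert (nA : ~ a i (All A)) by (intros H; now apply nx).
  destruct (classic (D (All A))) as [DA | nDA].
  - destruct (sample_point D a (All A) sm DA) as (y & ey & iy). exists y.
    rewrite e, ey, iy. split; [now intros z Hz|]. intros (_ & _ & HA).
    cbn [fst snd] in HA. apply nA, (sample_cluster _ _ sm (All A) i DA Di).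
    destruct (sample_prime _ _ sm _ DA) as [hT _].
    destruct (sample_fits _ _ sm _ DA) as [(B & eB & _) | (B & eB & HB)];
      [discriminate eB|]. injection eB as <-.
    exact (theory_mp _ hT _ _ HB HA).
  - destruct (canonical_stable_refuter (a i) A (sample_prime _ _ sm i Di) nA)
      as (T & pT & iT & HT & nT).
    destruct (sample_extend D a T (All A) sm pT) as (D' & b & sm' & D'A & bA & ext).
    + intros j Dj C HC. apply iT. now apply (sample_cluster _ _ sm j i).
    + exact sA.
    + right. eauto.
    + contradiction.
    + destruct (sample_point D' b (All A) sm' D'A) as (y & ey & iy). exists y.
      rewrite e, ey, iy. split.
      * intros [j C] (Dj & sC & HC). cbn [fst snd] in *.
        destruct (ext j Dj) as [D'j ab]. split; [exact D'j|]. split; [exact sC|].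
        now apply ab.
      * intros (_ & _ & HA). apply nT. now rewrite <- bA.
Qed.

Context (inh : inhabited point).

Definition point_frame : MIPC_frame :=
  Build_MIPC_frame point point_R point_E inh point_R_order point_E_equiv
    point_RE_comm.

Lemma point_Q (x y : point_frame) : Q x y <-> leq (prof x) (prof y).
Proof.
  split.
  - intros (z & [xz _] & zy). unfold E in zy. cbn in zy. now rewrite <- zy.
  - intros xy. destruct (point_reindex x y xy) as (w & wy & wx).
    exists w. split; [|exact wy]. split; [now rewrite wy | now symmetry].
Qed.

Definition point_valuation : valuation point_frame.
Proof.
  refine (Build_valuation point_frame (fun n x => prof x (idx x, Var n)) _).
  intros n x y Hx [xy e]. rewrite <- e. now apply xy.
Defined.

Lemma truth_profile A :
  In A (sub phi) ->
  forall x : point_frame, truth point_valuation x A <-> prof x (idx x, A).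
Proof.
  induction A as [n | A IHA B IHB | A IHA B IHB | A IHA B IHB | A IHA | A IHA | A IHA];
    intros HA x; cbn [truth].
  - reflexivity.
  - assert (In A (sub phi)) as sA 
      by (apply (sub_trans _ _ _ HA); right; apply in_app_iff; left; apply sub_self).
    assert (In B (sub phi)) as sB 
      by (apply (sub_trans _ _ _ HA); right; apply in_app_iff; right; apply sub_self).
    rewrite IHA, IHB by assumption.
    destruct (point_sample x) as (D & a & sm & Di & e). rewrite e.
    destruct (sample_prime _ _ sm _ Di) as [hT _].
    unfold profile; cbn [fst snd]. rewrite (theory_and _ hT). tauto.
  - assert (In A (sub phi)) as sA 
      by (apply (sub_trans _ _ _ HA); right; apply in_app_iff; left; apply sub_self).
    assert (In B (sub phi)) as sB 
      by (apply (sub_trans _ _ _ HA); right; apply in_app_iff; right; apply sub_self).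
    rewrite IHA, IHB by assumption.
    destruct (point_sample x) as (D & a & sm & Di & e). rewrite e.
    destruct (sample_prime _ _ sm _ Di) as (hT & T_or & _).
    unfold profile; cbn [fst snd]. split.
    + intros H. split; [exact Di|]. split; [exact HA|].
      apply theory_or; [exact hT | tauto].
    + intros (_ & _ & H). destruct (T_or _ _ H); tauto.
  - assert (In A (sub phi)) as sA 
      by (apply (sub_trans _ _ _ HA); right; apply in_app_iff; left; apply sub_self).
    assert (In B (sub phi)) as sB 
      by (apply (sub_trans _ _ _ HA); right; apply in_app_iff; right; apply sub_self).
    split.
    + intros H. apply NNPP. intros nx.
      destruct (point_refutes_imp x A B sA) as (y & xy & yA & yB); [intros D a sm Di e HAB|].
      * apply nx. rewrite e. now split.
      * apply yB, IHB, (H y xy), IHA; assumption.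
    + intros H y [xy e] HyA. apply IHA in HyA; [|exact sA]. apply IHB; [exact sB|].
      apply xy in H. rewrite e in H.
      destruct (point_sample y) as (D & a & sm & Di & ey). rewrite ey in *.
      destruct (sample_prime _ _ sm _ Di) as (hT & _).
      split; [exact Di|]. split; [exact sB|].
      exact (theory_mp _ hT A B (proj2 (proj2 H)) (proj2 (proj2 HyA))).
  - assert (In A (sub phi)) as sA by (apply (sub_trans _ _ _ HA); right; apply sub_self).
    split.
    + intros H. apply NNPP. intros nx.
      destruct (point_refutes_imp x A (Neg A) sA) as (y & xy & yA & yB);
        [intros D a sm Di e HAB|].
      * apply nx. rewrite e. split; [exact Di|]. split; [exact HA|].
        apply theory_neg_intro; [apply (sample_prime _ _ sm _ Di) | exact HAB].
      * apply (H y xy), IHA; assumption.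
    + intros H y [xy e] HyA. apply IHA in HyA; [|exact sA].
      apply xy in H. rewrite e in H.
      destruct (point_sample y) as (D & a & sm & Di & ey). rewrite ey in *.
      destruct (sample_prime _ _ sm _ Di) as (hT & _ & C & nC). apply nC.
      exact (theory_neg _ hT A C (proj2 (proj2 H)) (proj2 (proj2 HyA))).
  - assert (In A (sub phi)) as sA
      by (apply (sub_trans _ _ _ HA); right; right; apply sub_self).
    split.
    + intros H. apply NNPP. intros nx.
      destruct (point_refutes_all x A HA nx) as (y & xy & yA).
      apply yA, IHA, H, point_Q; assumption.
    + intros H y xy. apply point_Q in xy. apply xy in H. apply IHA; [exact sA|].
      destruct (point_sample y) as (D & a & sm & Di & ey). rewrite ey in *.
      destruct (sample_prime _ _ sm _ Di) as (hT & _).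
      destruct H as (Dx & _ & HxA).
      split; [exact Di|]. split; [exact sA|]. apply theory_all_T; [exact hT|].
      now apply (sample_cluster _ _ sm (idx x) (idx y)).
  - assert (In A (sub phi)) as sA by (apply (sub_trans _ _ _ HA); right; apply sub_self).
    destruct (point_sample x) as (D & a & sm & Di & e).
    destruct (sample_prime _ _ sm _ Di) as [hT _]. split.
    + intros (y & xy & HyA). apply IHA in HyA; [|exact sA].
      unfold E in xy; cbn in xy. unfold point_E in xy. rewrite <- xy, e in HyA.
      rewrite e. destruct HyA as (Dy & _ & HyA). cbn [fst snd] in *.
      split; [exact Di|]. split; [exact HA|].
      destruct (sample_prime _ _ sm _ Dy) as [hU _].
      apply (cluster_ex (a (idx y)) (a (idx x))); auto.
      * now apply (sample_cluster _ _ sm).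
      * now apply theory_ex_T.
    + rewrite e. intros (_ & _ & HxA). cbn [fst snd] in HxA.
      pose proof (sample_ex _ _ sm _ _ Di HA HxA) as Dex.
      destruct (sample_point D a (Ex A) sm Dex) as (y & ey & iy).
      exists y. split; [unfold E; cbn; unfold point_E; now rewrite e, ey|].
      apply IHA; [exact sA|]. rewrite ey, iy. split; [exact Dex|]. split; [exact sA|].
      destruct (sample_fits _ _ sm _ Dex) as [(B & eB & HB) | (B & eB & _)];
        [injection eB as ->; exact HB | discriminate eB].
Qed.
Lemma finite_point : Finite point.
Proof.
  destruct (finite_subsets (list_prod (sub phi) (sub phi))) as [L HL].
  apply (finite_sig _ (list_prod L (sub phi))).
  intros [X i] (D & a & sm & e & Di). cbn [fst snd] in *. apply in_prod.
  - apply HL. rewrite e. intros [j A] (Dj & sA & _). apply in_prod; [|exact sA].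
    exact (sample_index _ _ sm j Dj).
  - exact (sample_index _ _ sm i Di).
Qed.

Lemma point_frame_clean (x y : point_frame) : R x y -> Q y x -> x = y.
Proof.
  intros [xy e] yx. apply point_Q in yx.
  apply point_ext; [now apply leq_antisym | exact e].
Qed.
End Profiles.

(** Refuting [All phi] instead of [phi] makes the first point of the first sample
    one that has a name. *)
Lemma refuting_point phi :
  ~ MplusIPC phi -> exists x : point (All phi), ~ prof _ x (idx _ x, phi).
Proof.
  intros hphi.
  destruct (prime_extension (fun _ => False) (All phi)) as (T & pT & _ & nT).
  { intros D. apply hphi. apply der_empty. revert D. apply der_mp, der_thm.
    apply (axiom_instance phi phi phi _ ax_all_T). }
  destruct (canonical_stable_refuter T phi pT nT) as (U & pU & _ & HU & nU).
  destruct (sample_extend (All phi) (fun _ => False) (fun _ => U) U (All phi))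
    as (D & a & sm & Dk & ak & _); try easy.
  - constructor; easy.
  - right. eauto.
  - destruct (sample_point _ D a (All phi) sm Dk) as (x & ex & ix).
    exists x. rewrite ex, ix. intros (_ & _ & H). apply nU. now rewrite <- ak.
Qed.

Theorem theorem5p17 (phi : form) (hphi : ~ MplusIPC phi) :
  exists F : MIPC_frame, Finite (world F) /\ is_MplusIPC_frame F /\ ~ valid F phi.
Proof.
  destruct (refuting_point phi hphi) as [x nx].
  exists (point_frame (All phi) (inhabits x)).
  split; [exact (finite_point _)|]. split.
  - apply finite_clean_MCas; [exact (finite_point _) | apply point_frame_clean].
  - intros V. apply nx. apply (truth_profile (All phi) (inhabits x)); [|apply V].
    right. right. apply sub_self.
Qed.
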